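(* Let $p,q\geq 1$ be integers and let $\lambda_2$ be the second largest eigenvalue of the adjacency matrix of $\mathcal{R}(\mathrm{SPK}_{p,q+1})$. Then (a) $h(\mathcal{R}(\mathrm{SPK}_{p,q+1}))<\dfrac{2}{q}$, and (b) $\lambda_2>p+q-\dfrac{4}{q}$.
   Context: Graphs are finite, simple and undirected. $\mathrm{SPK}_{p,q}$ denotes the complete split graph whose vertex set is the disjoint union of a clique of size $p$ and an independent set of size $q$, with every vertex of the clique adjacent to every vertex of the independent set. A search tree $T$ on a connected graph $G$ is a rooted tree with vertex set $V(G)$, defined recursively: the root of $T$ is a chosen vertex $r\in V(G)$, and the children of $r$ are the roots of search trees on each of the connected components of $G-r$. Let $T$ be a search tree on $G$ and let $v$ be a child of $u$ in $T$. The $uv$-rotation transforms $T$ into the search tree $T'$ on $G$ such that: (i) $u$ is a child of $v$ in $T'$; if $u$ is the root of $T$ then $v$ is the root of $T'$, otherwise, if $p$ is the parent of $u$ in $T$, then $p$ is the parent of $v$ in $T'$; (ii) every subtree of $u$ in $T$ other than the one rooted at $v$ remains a subtree of $u$ in $T'$; (iii) each subtree $S$ of $v$ in $T$ becomes a subtree of $u$ in $T'$ if $u$ is adjacent in $G$ to some vertex of $S$, and otherwise remains a subtree of $v$. All other parent-child relations are unchanged. The rotation graph $\mathcal{R}(G)$ is the undirected graph whose vertices are the search trees on $G$, two search trees being adjacent if one is obtained from the other by a single rotation. It is $(|V(G)|-1)$-regular. The edge expansion of a graph $H$ is $h(H)=\min |\partial S|/|S|$ over nonempty $S\subseteq V(H)$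 with $|S|\leq |V(H)|/2$, where $\partial S$ is the set of edges with one endpoint in $S$ and the other in $V(H)\setminus S$. Eigenvalues $\lambda_1\geq\lambda_2\geq\dots$ are listed with multiplicity. *)

(* Defs.v *)
From HB Require Import structures.
From mathcomp Require Import all_boot all_order all_algebra.
From mathcomp Require Import polyrcf.
Set Implicit Arguments.
Unset Strict Implicit.
Unset Printing Implicit Defensive.
Import Order.TTheory GRing.Theory Num.Theory.
Local Open Scope ring_scope.

Record sgraph := SGraph {
  vertex :> finType;
  edge : rel vertex;
  edge_sym : symmetric edge;
  edge_irrefl : irreflexive edge }.

Section CompleteSplitGraph.
Variables p q : nat.

(* [inl] is the clique, [inr] the independent set. *)
Definition SPK_edge : rel ('I_p + 'I_q) := fun x y =>
  match x, y with
  | inl i, inl j => i != j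
  | inr _, inr _ => false
  | _, _ => true
  end.

Lemma SPK_edge_sym : symmetric SPK_edge.
Proof. by move=> [i|i] [j|j] //=; rewrite eq_sym. Qed.

Lemma SPK_edge_irrefl : irreflexive SPK_edge.
Proof. by move=> [i|i] //=; rewrite eqxx. Qed.

Definition SPK := SGraph SPK_edge_sym SPK_edge_irrefl.

End CompleteSplitGraph.

Section SearchTrees.
Variable G : sgraph.
Implicit Types (C D : {set G}) (u : option G) (T : {ffun G -> option G}).

Definition induced_edge C : rel G := fun x y => [&& x \in C, y \in C & edge x y].

(* Vertex sets of the connected components of the subgraph induced by C. *)
Definition components C : {set {set G}} :=
  equivalence_partition (connect (induced_edge C)) C.

(* A rooted tree on the vertices of G is encoded by its parent function [T],
   with [T r = None] for the root r.  [search_tree_on T u C] says that [T]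
   describes on C a search tree of the (connected) subgraph induced by C, whose
   root has parent [u]. *)
Inductive search_tree_on T : option G -> {set G} -> Prop :=
  SearchTreeOn u C r of r \in C & T r = u
    & (forall D, D \in components (C :\ r) -> search_tree_on T (Some r) D) :
    search_tree_on T u C.

(* Decision procedure for [search_tree_on], with fuel n at least #|C|. *)
Fixpoint search_treeb T n u C : bool :=
  if n is n'.+1 then
    [exists r in C, (T r == u) &&
      [forall D in components (C :\ r), search_treeb T n' (Some r) D]]
  else false.

Lemma component_sub C D : D \in components C -> D \subset C.
Proof.
by case/imsetP=> x _ ->; apply/subsetP=> y; rewrite inE => /andP[].
Qed.

Lemma component_ex C x :
  x \in C -> exists2 D, D \in components C & x \in D.
Proof.
move=> xC; exists [set y in C | connect (induced_edge C) x y].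
  by apply/imsetP; exists x.
by rewrite inE xC connect0.
Qed.

Lemma search_treeP T n u C :
  (#|C| <= n)%N -> reflect (search_tree_on T u C) (search_treeb T n u C).
Proof.
elim: n u C => [|n IHn] u C leCn /=.
  apply: (iffP idP) => // TC; case: TC leCn => {}u {}C r rC _ _.
  by rewrite leqn0 cards_eq0 => /eqP C0; rewrite C0 inE in rC.
have leD r D : r \in C -> D \in components (C :\ r) -> (#|D| <= n)%N.
  move=> rC /component_sub/subset_leq_card leD; apply: leq_trans leD _.
  by move: leCn; rewrite (cardsD1 r) rC.
apply: (iffP exists_inP) => [[r rC /andP[/eqP Tr /forall_inP TD]]|].
  apply: (SearchTreeOn rC Tr) => D CD.
  by apply/(IHn _ _ (leD r D rC CD)); apply: TD.
move=> TC; case: TC leCn leD => {}u {}C r rC Tr TD leCn leD.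
exists r => //; rewrite Tr eqxx; apply/forall_inP => D CD.
by apply/(IHn _ _ (leD r D rC CD)); apply: TD.
Qed.

Lemma search_tree_parent T u C x y :
  search_tree_on T u C -> x \in C -> T x = Some y -> y \in C \/ u = Some y.
Proof.
move=> TC; elim: TC x => {}u {}C r rC Tr _ IH x xC Tx.
have [xr|xr] := eqVneq x r; first by right; rewrite -Tr -xr.
have [|D CD xD] := @component_ex (C :\ r) x; first by rewrite !inE xr.
have /subsetP sDC := component_sub CD; left.
case: (IH D CD x xD Tx) => [/sDC|[<-] //].
by rewrite inE => /andP[].
Qed.

Lemma search_tree_no2cycle T u C x y :
    search_tree_on T u C -> (forall z, u = Some z -> z \notin C) ->
  x \in C -> y \in C -> T x = Some y -> T y <> Some x.
Proof.
move=> TC; elim: TC x y => {}u {}C r rC Tr TD IH x y uC xC yC Tx Ty.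
have root z t : z \in C -> t \in C -> T z = Some t -> z != r.
  move=> zC tC Tz; apply/eqP => zr; rewrite zr Tr in Tz.
  by move: (uC _ Tz); rewrite tC.
have xr := root _ _ xC yC Tx; have yr := root _ _ yC xC Ty.
have [|D CD xD] := @component_ex (C :\ r) x; first by rewrite !inE xr.
case: (search_tree_parent (TD D CD) xD Tx) => [yD|[ry]]; last first.
  by rewrite ry eqxx in yr.
apply: (IH D CD x y _ xD yD Tx Ty) => z [<-].
by apply/negP => /(subsetP (component_sub CD)); rewrite !inE eqxx.
Qed.

(* Search trees on G, for G connected. *)
Record search_tree := SearchTree {
  parent :> {ffun G -> option G};
  _ : search_treeb parent #|G| None [set: G] }.

HB.instance Definition _ := [isSub for parent].
HB.instance Definition _ := [Finite of search_tree by <:].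

Lemma search_tree_parentP (T : search_tree) : search_tree_on T None [set: G].
Proof.
case: T => T /= valT.
by apply: (elimT (search_treeP T None _)) valT; rewrite cardsT.
Qed.

(* Vertices of the subtree rooted at w. *)
Definition subtree T (w : G) : {set G} :=
  [set x | connect (fun a b => T a == Some b) x w].

(* Parent function after the uv-rotation, for v a child of u. *)
Definition rotate T (u v : G) : {ffun G -> option G} :=
  [ffun w =>
    if w == u then Some v
    else if w == v then T u
    else if (T w == Some v) && [exists x in subtree T w, edge u x] then Some u
    else T w].

Definition rotates_to (T T' : search_tree) : bool :=
  [exists u, exists v, (T v == Some u) && (parent T' == rotate T u v)].

Definition rotation_edge : rel search_tree :=
  fun T T' : search_tree => rotates_to T T' || rotates_to T' T.

Lemma rotation_edge_sym : symmetric rotation_edge.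
Proof. by move=> T T'; rewrite /rotation_edge orbC. Qed.

Lemma rotation_edge_irrefl : irreflexive rotation_edge.
Proof.
move=> T; rewrite /rotation_edge orbb; apply/existsP => -[u /existsP[v]].
case/andP=> /eqP Tv /eqP/ffunP/(_ u); rewrite ffunE eqxx => Tu.
by apply: (search_tree_no2cycle (search_tree_parentP T) _ _ _ Tu Tv) => //=;
  rewrite inE.
Qed.

Definition rotation_graph := SGraph rotation_edge_sym rotation_edge_irrefl.

End SearchTrees.

Section GraphParameters.
Variables (R : rcfType) (H : sgraph).

Definition edge_boundary (A : {set H}) : {set {set H}} :=
  [set [set x; y] | x in A, y in ~: A & edge x y].

Definition expansion_ratios : seq R :=
  [seq #|edge_boundary A|%:R / #|A|%:R
     | A : {set H} in [pred A : {set H} | (A != set0) && (#|A|.*2 <= #|H|)%N]].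

(* Minimum of the nonempty list of ratios (0 if H has at most one vertex); the
   neutral element [head 0 _] is itself one of the ratios. *)
Definition edge_expansion : R :=
  \big[Num.min/head 0 expansion_ratios]_(x <- expansion_ratios) x.

Definition adjacency_mx : 'M[R]_#|H| :=
  \matrix_(i, j) (edge (enum_val i) (enum_val j))%:R.

End GraphParameters.

(* Eigenvalues in R, with (algebraic) multiplicity, in nonincreasing order. *)
Definition eigenvalues (R : rcfType) n (A : 'M[R]_n) : seq R :=
  sort >=%R
    (flatten [seq nseq (mup x (char_poly A)) x | x <- rootsR (char_poly A)]).

(* Second largest adjacency eigenvalue; list indices start at 0. *)
Definition lambda2 (R : rcfType) (H : sgraph) : R :=
  nth 0 (eigenvalues (adjacency_mx R H)) 1.

(* Main.v *)
Require Import Defs.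
From mathcomp Require Import all_boot all_order all_algebra.
From mathcomp Require Import perm polyrcf complex zify ring.
Import Order.TTheory GRing.Theory Num.Theory.

(** A search tree on the complete split graph is a chain of vertices down to the
    last clique vertex, below which all the remaining independent vertices hang
    as leaves.  It is therefore a word: a duplicate-free list of vertices that
    contains the whole clique and ends with a clique vertex.  On words, a
    rotation exchanges two adjacent letters, or inserts or deletes an
    independent letter just before the last letter ([rotates_step]).

    Fix two independent vertices a and b, and let A be the set of trees in which
    a is a proper ancestor of b.  Exchanging the names a and b maps A into its
    complement, so A contains at most half of the trees.  A rotation leaves A
    only if it exchanges an adjacent pair a, b, or if it deletes a from the
    position before the last letter while b is a leaf ([boundary_words]).

    Both A and its boundary are counted by erasing a and b.  Over a base word of
    length m there are m (m + 3) / 2 trees of A and m + 1 edges leaving A.  The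
    bound |boundary of A| < (2 / q) |A| thus reads
      q * sum (m + 1) < sum m (m + 3),
    the sums being over all base words.  For a single short word it can fail, but
    short words are rare.  Let l = p + q - 1 - m be the number of
    independent letters, other than a and b, that do not occur in a base word.
    Prepending such a letter to the word is an injection into the base words
    that begin with an independent letter, so the average of l is less than 1
    ([leaves_lt]).  As m (m + 3) - q (m + 1) is at least an affine function
    of l, with slope -(2 p + q), averaging gives the inequality for q > 1; for
    q = 1 it holds term by term ([cut_lt]).

    The eigenvalue bound is the easy half of Cheeger's inequality.  Every tree
    has at least p + q neighbours, one for each edge of the tree
    ([rotation_degree]).  Hence, on the plane of the vectors that are constant on
    A and on its complement, the quadratic form of the adjacency matrix is at
    least p + q - 2 |boundary of A| / |A| times the squared norm.  By the
    spectral theorem, a plane on which the form is bounded below in this way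
    forces the second largest eigenvalue to be at least that bound
    ([second_eigenvalue_ge], [lambda2_ge_cut]). *)

Set Implicit Arguments.
Unset Strict Implicit.
Unset Printing Implicit Defensive.

(** * The second largest eigenvalue of a symmetric matrix *)

Section Spectral.
Local Open Scope ring_scope.
Local Open Scope sesquilinear_scope.

Lemma char_poly_similar (F : comUnitRingType) n (P D : 'M[F]_n) :
  P \in unitmx -> char_poly (invmx P *m D *m P) = char_poly D.
Proof.
move=> Pu; rewrite /char_poly /char_poly_mx.
have PP : map_mx polyC (invmx P) *m map_mx polyC P = 1%:M.
  by rewrite -map_mxM mulVmx // map_mx1.
have -> : 'X%:M - map_mx polyC (invmx P *m D *m P) =
    map_mx polyC (invmx P) *m ('X%:M - map_mx polyC D) *m map_mx polyC P.
  by rewrite mulmxBr mulmxBl !map_mxM /= mul_mx_scalar -scalemxAl PP scalemx1.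
by rewrite !det_mulmx mulrAC -det_mulmx PP det1 mul1r.
Qed.

Lemma eigenvalues_perm (R : rcfType) n (A : 'M[R]_n) (s : seq R) :
  char_poly A = \prod_(x <- s) ('X - x%:P) -> perm_eq (eigenvalues A) s.
Proof.
move=> As; rewrite /eigenvalues perm_sort; apply/allP => x _; apply/eqP.
have A0 : char_poly A != 0 by rewrite monic_neq0 ?char_poly_monic.
rewrite count_flatten -map_comp -mu_prod_XsubC -As.
rewrite (eq_map (g := fun y => if y == x then mup x (char_poly A) else 0%N));
  last first.
  by move=> y /=; rewrite count_nseq /=; case: eqP => [->|_]; rewrite ?mul1n.
rewrite sumnE big_map -big_mkcond /=.
have [rx|rx] := boolP (root (char_poly A) x); last first.
  by rewrite mupNroot // big1.
have xr : x \in rootsR (char_poly A) by rewrite -roots_on_rootsR // inE rx.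
rewrite big_mkcond (bigD1_seq x) ?uniq_roots //= eqxx big1 ?addn0 //.
by move=> y /negPf->.
Qed.

(** The spectral theorem is available over the algebraically closed field
    [R[i]], where a real symmetric matrix is hermitian; its eigenvalues are then
    real, so that the diagonal can be taken over [R]. *)
Lemma symmetric_diagonalization (R : rcfType) n (A : 'M[R]_n) : A^T = A ->
  exists (P : 'M[R[i]]_n) (d : 'rV[R]_n), P \is unitarymx
    /\ map_mx (real_complex R) A =
         invmx P *m diag_mx (map_mx (real_complex R) d) *m P.
Proof.
move=> At; set B := map_mx _ A.
have Bh : B \is hermsymmx.
  apply: realsym_hermsym.
    apply/is_hermitianmxP; rewrite expr0 scale1r /B map_trmx At.
    by apply/matrixP=> i j; rewrite !mxE.
  by apply/mxOverP => i j; rewrite mxE complex_real.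
have /mxOverP dr := hermitian_spectral_diag_real Bh.
exists (spectralmx B), (map_mx (@complex.Re R) (spectral_diag B)).
split; first exact: spectral_unitarymx.
rewrite -map_mx_comp (_ : map_mx _ (spectral_diag B) = spectral_diag B).
  exact/orthomx_spectralP/hermitian_normalmx.
by apply/rowP=> j; rewrite mxE /= RRe_real.
Qed.

Lemma eigenvalues_diag (R : rcfType) n (A : 'M[R]_n) (P : 'M[R[i]]_n)
    (d : 'rV[R]_n) :
    P \is unitarymx ->
    map_mx (real_complex R) A =
      invmx P *m diag_mx (map_mx (real_complex R) d) *m P ->
  perm_eq (eigenvalues A) [seq d 0 i | i <- enum 'I_n].
Proof.
move=> Pu AP; apply: eigenvalues_perm.
apply: (map_poly_inj (real_complex R)).
rewrite map_char_poly AP char_poly_similar ?unitarymx_unit //.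
rewrite char_poly_trig ?diag_mx_is_trig // big_map big_enum rmorph_prod /=.
by apply: eq_bigr => i _; rewrite !mxE eqxx mulr1n map_polyXsubC.
Qed.

(** The eigenvalues are sorted in nonincreasing order, so only the first of them
    can reach a bound that the second one does not. *)
Lemma second_largest_lt (R : rcfType) n (A : 'M[R]_n) (d : 'rV[R]_n) (mu : R) :
    perm_eq (eigenvalues A) [seq d 0 i | i <- enum 'I_n] -> (0 < n)%N ->
    nth 0 (eigenvalues A) 1 < mu ->
  exists i0 : 'I_n, forall i, i != i0 -> d 0 i < mu.
Proof.
move=> eigd n0 lt_mu.
have : (count (>= mu) [seq d 0%R i | i <- enum 'I_n] <= 1)%N.
  rewrite -(seq.permP eigd).
  have : sorted >=%R (eigenvalues A) by apply: sort_sorted; apply: ge_total.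
  case: (eigenvalues A) lt_mu => [|x [|y t]] //=; first by rewrite addn0 leq_b1.
  move=> lt_mu /andP[_ yt]; rewrite [mu <= y]leNgt lt_mu add0n.
  rewrite (eq_in_count (a2 := pred0)) ?count_pred0 ?addn0 ?leq_b1 // => z zt.
  rewrite /= leNgt (le_lt_trans _ lt_mu) //.
  by have /allP/(_ z zt) := order_path_min ge_trans yt.
rewrite count_map => le1.
have [i0 di0|dlt] := pickP (fun i : 'I_n => mu <= d 0 i); last first.
  by exists (Ordinal n0) => i _; rewrite ltNge dlt.
exists i0 => i ii0; rewrite ltNge; apply/negP => di.
suff : (1 < count (preim (d 0%R) (>= mu)) (enum 'I_n))%N by rewrite ltnNge le1.
rewrite -size_filter; apply: (@uniq_leq_size _ [:: i; i0]).
  by rewrite /= inE ii0.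
move=> j; rewrite !inE => /orP[]/eqP->; rewrite mem_filter /= mem_enum.
  by rewrite di.
by rewrite di0.
Qed.

(** One half of the Courant-Fischer principle.  If all the eigenvalues but one
    were less than [mu], then some nonzero vector of the plane spanned by the
    rows of [U] would have no component along the exceptional eigenvector, and
    the quadratic form would be less than [mu] times the squared norm there. *)
Lemma second_eigenvalue_ge (R : rcfType) n (A : 'M[R]_n) (mu : R)
    (U : 'M[R[i]]_(2, n)) :
    A^T = A -> row_free U ->
    (forall c : 'rV_2, let x := c *m U in
       mu%:C%C * (x *m x^t*) 0 0
         <= (x *m map_mx (real_complex R) A *m x^t*) 0 0) ->
  mu <= nth 0 (eigenvalues A) 1.
Proof.
move=> At Ufree Uge; rewrite leNgt; apply/negP => lt_mu.
have [P [d [Pu AP]]] := symmetric_diagonalization At.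
have n1 : (1 < n)%N by rewrite -(eqP Ufree) rank_leq_col.
have [i0 d_lt] := second_largest_lt (eigenvalues_diag Pu AP) (ltnW n1) lt_mu.
(* The column of the exceptional coordinates of the two rows of [U] has rank at
   most 1, hence a nonzero left kernel. *)
pose M := U *m P^t* *m delta_mx i0 (0 : 'I_1).
have /rowV0Pn[c /sub_kermxP cM c0] : kermx M != 0.
  by rewrite kermx_eq0 /row_free neq_ltn ltnS rank_leq_col.
pose y := c *m U *m P^t*.
have xy : c *m U = y *m P.
  by rewrite /y -invmx_unitary // mulmxKV ?unitarymx_unit.
have y0 : y 0 i0 = 0.
  move: cM => /matrixP/(_ 0 0); rewrite !mulmxA -/y; move: y {xy} => y.
  rewrite mxE (bigD1 i0) //= big1 => [|j ji0].
    by rewrite mxE !eqxx mulr1 addr0 mxE.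
  by rewrite mxE (negPf ji0) mulr0.
have ynz : y != 0.
  apply: contraNneq c0 => y00.
  by rewrite -(mulmx_free_eq0 _ Ufree) xy y00 mul0mx.
have {Uge} := Uge c; rewrite /= xy AP.
move: y y0 ynz {cM xy} => y y0 ynz.
rewrite trmx_mul map_mxM !mulmxA mulmxtVK //.
rewrite -!mulmxA (mulmxA P) mulmxV ?unitarymx_unit // mul1mx.
rewrite (mulmxA P) (unitarymxP Pu) mul1mx.
rewrite mxE mulr_sumr mul_diag_mx mxE; apply/negP; rewrite lt_geF //.
have [i yi] : exists i, y 0 i != 0.
  apply/existsP; apply: contraNT ynz => /existsPn y00.
  by apply/eqP/rowP => i; rewrite mxE; apply/eqP; rewrite -[_ == _]negbK y00.
have ii0 : i != i0 by apply: contraNneq yi => ->; rewrite y0.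
rewrite (bigD1 i) //= [ltRHS](bigD1 i) //=.
apply: ltr_leD; last apply: ler_sum => j _.
  rewrite !mxE mulrCA -normCK ltr_pM2r ?ltcR ?d_lt //.
  by rewrite exprn_gt0 ?normr_gt0.
rewrite !mxE mulrCA -normCK; have [->|ji0] := eqVneq j i0.
  by rewrite y0 normr0 expr0n !mulr0.
by rewrite ler_wpM2r ?exprn_ge0 // lecR ltW ?d_lt.
Qed.

End Spectral.

(** * Edge cuts, expansion and the second eigenvalue of a graph *)

Section Cuts.
Local Open Scope ring_scope.
Local Open Scope sesquilinear_scope.

(** Each boundary edge occurs once, as the pair whose first component is in [A];
    ordered pairs are easier to sum over than sets of two vertices. *)
Definition cut (H : sgraph) (A : {set H}) : {set H * H} :=
  [set e | [&& e.1 \in A, e.2 \notin A & edge e.1 e.2]].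

Lemma adjacency_mx_sym (R : rcfType) (H : sgraph) :
  (adjacency_mx R H)^T = adjacency_mx R H.
Proof. by apply/matrixP=> i j; rewrite !mxE edge_sym. Qed.

Lemma sum_enum_val (V : nmodType) (T : finType) (F : T -> V) :
  \sum_(i < #|T|) F (enum_val i) = \sum_x F x.
Proof.
rewrite [RHS](reindex (fun i : 'I_#|T| => enum_val i)) //.
by apply: onW_bij; apply: enum_val_bij.
Qed.

Lemma sum_cut (V : nmodType) (H : sgraph) (A : {set H}) (F : H -> H -> V) :
  \sum_(x in A) \sum_(y | y \notin A) F x y *+ edge x y =
    \sum_(e in cut A) F e.1 e.2.
Proof.
rewrite pair_big /= big_mkcond [RHS]big_mkcond; apply: eq_bigr => -[x y] _ /=.
by rewrite inE /= andbA; case: (_ && _); case: edge.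
Qed.

(** The easy half of Cheeger's inequality.  The test vectors are those that are
    constant on [A] and on its complement, with values [c 0 0] and [c 0 1]; for
    them the quadratic form is the degree-weighted squared norm minus
    [#|cut A|] times the square of [`|c 0 0 - c 0 1|]. *)
Lemma lambda2_ge_cut (R : rcfType) (H : sgraph) (A : {set H}) (d : nat) :
    (forall x : H, (d <= #|[set y | edge x y]|)%N) ->
    A != set0 -> (#|A|.*2 <= #|H|)%N ->
  d%:R - 2 * #|cut A|%:R / #|A|%:R <= lambda2 R H.
Proof.
move=> degH A0 leA; set C := (R[i])%type; set a : R := _ / _.
have A_gt0 : (0 < #|A|)%N by rewrite card_gt0.
have cA : (#|A| <= #|~: A|)%N by rewrite -(leq_add2l #|A|) cardsC addnn.
pose f (c : 'rV[C]_2) x : C := if x \in A then c 0 0 else c 0 1.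
pose U : 'M[C]_(2, #|H|) :=
  \matrix_(i, j) ((enum_val j \in A) == (i == 0))%:R.
have cU c j : (c *m U) 0 j = f c (enum_val j).
  rewrite mxE big_ord_recl big_ord1 !mxE /f.
  have -> : lift ord0 ord0 = 1 :> 'I_2 by apply/val_inj.
  by case: (_ \in A); rewrite /= ?mulr1 ?mulr0 ?addr0 ?add0r.
apply: (@second_eigenvalue_ge R _ _ _ U); first exact: adjacency_mx_sym.
  apply: inj_row_free => c /rowP c0.
  have f0 x : f c x = 0 by have := c0 (enum_rank x); rewrite cU enum_rankK mxE.
  have /set0Pn[x xA] := A0; have /card_gt0P[y] := leq_trans A_gt0 cA.
  rewrite inE => yA; move: (f0 x) (f0 y); rewrite /f xA (negPf yA) => c00 c01.
  apply/rowP=> j; rewrite mxE; case: (unliftP 0 j) => [k|] -> //.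
  by rewrite ord1 (_ : lift _ _ = 1) //; apply/val_inj.
move=> c; cbv zeta.
have -> : ((c *m U) *m (c *m U)^t*) 0 0 = \sum_v `|f c v| ^+ 2.
  rewrite mxE -(sum_enum_val (fun v => `|f c v| ^+ 2)); apply: eq_bigr => j _.
  by rewrite !mxE -!(cU c) normCK !mxE.
have -> : ((c *m U) *m map_mx (real_complex R) (adjacency_mx R H)
    *m (c *m U)^t*) 0 0 = \sum_u \sum_v (f c u * (f c v)^*) *+ edge u v.
  rewrite mxE exchange_big.
  rewrite -(sum_enum_val (fun v => \sum_u (f c u * (f c v)^*) *+ edge u v)).
  apply: eq_bigr => j _; rewrite mxE mulr_suml.
  rewrite -(sum_enum_val (fun u => (f c u * (f c _)^*) *+ edge u _)).
  apply: eq_bigr => i _; rewrite cU mxE mxE [in RHS]mulrC mxE mxE cU.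
  by case: edge; rewrite /= ?rmorph1 ?rmorph0 ?(mulr1, mulr0, mul0r) // mulrC.
have -> : \sum_u \sum_v (f c u * (f c v)^*) *+ edge u v =
    \sum_u `|f c u| ^+ 2 *+ #|[set v | edge u v]|
      - `|c 0 0 - c 0 1| ^+ 2 *+ #|cut A|.
  pose g u v := (`|f c u| ^+ 2 - f c u * (f c v)^*) *+ edge u v.
  have -> : \sum_u `|f c u| ^+ 2 *+ #|[set v | edge u v]| =
      \sum_u \sum_v (f c u * (f c v)^*) *+ edge u v + \sum_u \sum_v g u v.
    rewrite -big_split; apply: eq_bigr => u _; rewrite -big_split /=.
    rewrite -sum1dep_card -sumrMnr big_mkcond; apply: eq_bigr => v _ /=.
    by rewrite /g mulrnBl addrC subrK; case: edge.
  suff -> : \sum_u \sum_v g u v = `|c 0 0 - c 0 1| ^+ 2 *+ #|cut A|.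
    by rewrite addrK.
  have g0 u v : (u \in A) = (v \in A) -> g u v = 0.
    by move=> uv; rewrite /g /f uv -normCK subrr mul0rn.
  rewrite (bigID (mem A)) /=.
  rewrite (eq_bigr (fun u => \sum_(v | v \notin A) g u v)); last first.
    move=> u uA; rewrite (bigID (mem A)) /= big1 ?add0r // => v vA.
    by rewrite g0 ?uA.
  rewrite [X in _ + X](eq_bigr (fun u => \sum_(v in A) g u v)); last first.
    move=> u uA; rewrite (bigID (mem A)) /= [X in _ + X]big1 ?addr0 // => v vA.
    by rewrite g0 // (negPf uA) (negPf vA).
  rewrite [X in _ + X]exchange_big -big_split /=.
  rewrite (eq_bigr (fun u =>
      \sum_(v | v \notin A) `|c 0 0 - c 0 1| ^+ 2 *+ edge u v)).
    by rewrite sum_cut sumr_const.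
  move=> u uA; rewrite -big_split /=; apply: eq_bigr => v vA.
  rewrite /g [edge v u]edge_sym -mulrnDl /f uA (negPf vA); congr (_ *+ _).
  by rewrite !normCK rmorphB /=; ring.
set N := \sum_v `|f c v| ^+ 2.
have NE : N = `|c 0 0| ^+ 2 *+ #|A| + `|c 0 1| ^+ 2 *+ #|~: A|.
  rewrite /N (bigID (mem A)) /= -!sumr_const; congr (_ + _).
    by apply: eq_bigr => v vA; rewrite /f vA.
  by apply: eq_big => [v|v vA]; rewrite ?inE // /f (negPf vA).
have degN : N *+ d <= \sum_u `|f c u| ^+ 2 *+ #|[set v | edge u v]|.
  by rewrite -sumrMnl; apply: ler_sum => u _; rewrite ler_wpMn2l ?exprn_ge0.
have cutN : `|c 0 0 - c 0 1| ^+ 2 *+ #|A| <= 2 * N.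
  (* Parallelogram law. *)
  have par : `|c 0 0 - c 0 1| ^+ 2 <= 2 * (`|c 0 0| ^+ 2 + `|c 0 1| ^+ 2).
    have -> : 2 * (`|c 0 0| ^+ 2 + `|c 0 1| ^+ 2) =
        `|c 0 0 - c 0 1| ^+ 2 + `|c 0 0 + c 0 1| ^+ 2.
      by rewrite !normCK rmorphB rmorphD /=; ring.
    by rewrite lerDl exprn_ge0.
  apply: le_trans (ler_wMn2r #|A| par) _.
  rewrite -mulrnAr ler_pM2l ?ltr0n // NE mulrnDl.
  by rewrite lerD2l ler_wpMn2l ?exprn_ge0.
have -> : (d%:R - a)%:C%C = d%:R - 2 * #|cut A|%:R / #|A|%:R :> C.
  by rewrite rmorphB rmorph_nat fmorph_div rmorphM !rmorph_nat.
rewrite mulrBl lerB // ?mulr_natl //.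
rewrite mulrAC ler_pdivlMr ?ltr0n // mulr_natr mulrnAl mulr_natl.
by rewrite mulrnAC [leRHS]mulrnAC ler_wMn2r // -[leRHS]mulr_natl.
Qed.

Lemma card_edge_boundary (H : sgraph) (A : {set H}) :
  (#|edge_boundary A| <= #|cut A|)%N.
Proof.
apply: leq_trans (leq_imset_card (fun e => [set e.1; e.2]) (cut A)).
apply/subset_leq_card/subsetP => _ /imset2P[x y xA + ->].
rewrite !inE => /andP[yA xy]; apply/imsetP; exists (x, y) => //.
by rewrite !inE xA yA.
Qed.

Lemma edge_expansion_le_cut (R : rcfType) (H : sgraph) (A : {set H}) :
    A != set0 -> (#|A|.*2 <= #|H|)%N ->
  edge_expansion R H <= #|cut A|%:R / #|A|%:R.
Proof.
move=> A0 leA.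
have inA : #|edge_boundary A|%:R / #|A|%:R \in expansion_ratios R H.
  by apply/imageP; exists A => //; rewrite inE A0.
apply: (bigmin_inf_seq _ _ xpredT _ id inA) => //.
by rewrite ler_wpM2r ?invr_ge0 // ler_nat card_edge_boundary.
Qed.

End Cuts.

(** * The parent function of a word *)

Section ParentIn.
Variable V : eqType.
Implicit Types (u : option V) (x y : V) (w s t : seq V).

(** The letters of [w] form a chain hanging under [u]; every vertex that does not
    occur in [w] is a leaf under the last letter. *)
Fixpoint parent_in u w x : option V :=
  if w is y :: s then if x == y then u else parent_in (Some y) s x else u.

Lemma parent_in_cat u s t x :
  parent_in u (s ++ t) x =
    if x \in s then parent_in u s x else parent_in (last u (map Some s)) t x.
Proof.
elim: s u => [//|y s IHs] u /=; rewrite inE.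
by case: eqP => //= _; rewrite IHs.
Qed.

Lemma parent_in_notin u w x :
  x \notin w -> parent_in u w x = last u (map Some w).
Proof. by move=> xw; rewrite -[w]cats0 parent_in_cat (negPf xw) cats0. Qed.

Lemma parent_in_Some y w x : parent_in (Some y) w x <> None.
Proof. by elim: w y => [|z w IHw] y //=; case: eqP. Qed.

Lemma parent_in_range u w x y :
  parent_in u w x = Some y -> u = Some y \/ y \in w.
Proof.
elim: w u => [|z w IHw] u /=; first by left.
case: eqP => [_|_]; first by left.
by case/IHw => [[->]|yw]; right; rewrite inE ?eqxx ?yw ?orbT.
Qed.

(** Only the topmost vertices, which hang directly under [u], notice a change of
    [u]. *)
Lemma parent_in_change u u' w x y :
    u = Some y -> y \notin w -> parent_in u w x <> Some y ->
  parent_in u' w x = parent_in u w x.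
Proof. by move=> -> yw; case: w yw => [|z w] //= yw; case: eqP. Qed.

Lemma parent_in_eq u w x y :
    u = Some y -> y \notin w -> parent_in u w x = Some y ->
  w = [::] \/ exists t, w = x :: t.
Proof.
move=> -> ; case: w => [|z w] /=; first by left.
rewrite inE negb_or => /andP[yz yw].
case: eqP => [->|_]; first by right; exists w.
by case/parent_in_range => [[zy]|]; [rewrite zy eqxx in yz|rewrite (negPf yw)].
Qed.

Lemma parent_in_SomeP w x y : uniq w -> parent_in None w x = Some y ->
  (exists s t, w = s ++ [:: y, x & t])
  \/ (x \notin w /\ exists s, w = rcons s y).
Proof.
move=> uw; have lastP s :
    last None (map Some s) = Some y -> exists s', s = rcons s' y.
  case/lastP: s => [|s z] //; rewrite map_rcons last_rcons => -[->].
  by exists s.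
have [xw|xw] := boolP (x \in w); last first.
  by rewrite parent_in_notin // => /lastP; right.
case/splitPr: xw uw => s1 s2; rewrite cat_uniq /= => /and3P[_ xs1 _].
rewrite parent_in_cat (negPf (norP xs1).1) /= eqxx => /lastP[s ->].
by left; exists s, s2; rewrite cat_rcons.
Qed.

(** This makes the parent relation acyclic. *)
Lemma parent_in_index w x y :
  uniq w -> parent_in None w x = Some y -> index y w < index x w.
Proof.
move=> uw /(parent_in_SomeP uw) [[s [t wE]]|[xw [s wE]]]; subst w.
  move: uw; rewrite cat_uniq /= !inE !negb_or.
  case/and3P=> _ /and3P[ys xs _] /andP[/andP[yx _] _].
  by rewrite !index_cat (negPf ys) (negPf xs) /= eqxx (negPf yx) ltn_add2l.
by rewrite [index x _]memNindex // index_mem mem_rcons inE eqxx.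
Qed.

End ParentIn.

(** * Search trees on the complete split graph are words *)

Section Words.
Variables p n : nat.
Let V : finType := SPK p n.
Implicit Types (x y : V) (w s t : seq V).

Definition clique x := if x is inl _ then true else false.

Lemma SPK_edgeE x y :
  edge (s := SPK p n) x y = (x != y) && (clique x || clique y).
Proof. by case: x y => [i|i] [j|j]; rewrite /= ?andbT ?andbF. Qed.

(** Once the clique is exhausted, the remaining vertices are pairwise nonadjacent,
    so that in a search tree they are leaves below the last clique vertex and
    none of them is put into the word.  The empty word is accepted so that the
    condition passes to all suffixes. *)
Definition clique_end w := if w is x :: s then clique (last x s) else true.

Lemma clique_end_cat s x t : clique_end (s ++ x :: t) = clique_end (x :: t).
Proof. by case: s => [|y s] //=; rewrite last_cat. Qed.

(** For [C] containing a clique vertex, these are the words of the search trees on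
    the subgraph induced by [C]. *)
Definition spans (C : {set V}) w := [/\ uniq w, {subset w <= C},
  forall x, x \in C -> clique x -> x \in w & clique_end w].

Definition valid w :=
  [&& uniq w, [forall x, clique x ==> (x \in w)] & clique_end w].

Lemma validP w : reflect (spans setT w) (valid w).
Proof.
apply: (iffP and3P) => [[uw /forallP cw ew]|[uw _ cw ew]]; split=> //.
- by move=> x _; rewrite inE.
- by move=> x _; apply: implyP (cw x).
- by apply/forallP=> x; apply/implyP; apply: cw; rewrite inE.
Qed.

(** A clique vertex is adjacent to all other vertices, so that a vertex set which
    contains one is connected. *)
Lemma component_clique (C D : {set V}) x :
  x \in C -> clique x -> D \in components (G := SPK p n) C -> D = C.
Proof.
move=> xC cx /imsetP[y yC ->]; apply/setP=> z; rewrite inE andb_idr // => zC.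
have step a b : a \in C -> b \in C -> clique a || clique b ->
    connect (induced_edge (G := SPK p n) C) a b.
  move=> aC bC ab; have [->|ne] := eqVneq a b; first exact: connect0.
  by apply: connect1; rewrite /induced_edge SPK_edgeE aC bC ne.
apply: (connect_trans (step y x yC xC _) (step x z xC zC _)); last by rewrite cx.
by rewrite cx orbT.
Qed.

Lemma component_indep (C D : {set V}) : (forall x, x \in C -> ~~ clique x) ->
  D \in components (G := SPK p n) C -> exists2 x, x \in C & D = [set x].
Proof.
move=> iC /imsetP[y yC ->]; exists y => //; apply/setP=> z; rewrite !inE.
apply/idP/eqP=> [/andP[_]|->]; last by rewrite yC connect0.
case/connectP=> -[|a s] //= /andP[/and3P[_ aC]].
by rewrite SPK_edgeE (negPf (iC _ yC)) (negPf (iC _ aC)) andbF.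
Qed.

Lemma search_tree_of_word (T : {ffun V -> option V}) u (C : {set V}) w c :
    c \in C -> clique c -> spans C w ->
    (forall x, x \in C -> T x = parent_in u w x) ->
  search_tree_on (G := SPK p n) T u C.
Proof.
elim: w u C c => [|r w IHw] u C c cC cc [uw wC Cw ew] Tw.
  by have := Cw c cC cc.
have rC : r \in C by apply: wC; rewrite mem_head.
move: uw => /= /andP[rw uw].
apply: (SearchTreeOn rC); first by rewrite Tw //= eqxx.
have Tw' x : x \in C :\ r -> T x = parent_in (Some r) w x.
  by case/setD1P=> xr /Tw; rewrite /= (negPf xr).
have sC : spans (C :\ r) w.
  split=> // [x xw|x /setD1P[xr xC] cx|].
  - rewrite !inE wC ?inE ?xw ?orbT // andbT.
    by apply: contraNneq rw => <-.
  - by have := Cw x xC cx; rewrite inE (negPf xr).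
  - by case: (w) ew.
case: w {IHw}(IHw (Some r)) ew rw uw wC Cw Tw Tw' sC
  => [|y w] IHw ew rw uw wC Cw Tw Tw' sC D.
  (* The root is the last clique vertex: the components are single leaves. *)
  case/component_indep => [x /setD1P[xr xC]|x /Tw' /= Tx ->].
    by apply/negP => /(Cw x xC); rewrite inE (negPf xr).
  apply: (@SearchTreeOn _ _ _ _ x); rewrite ?inE ?eqxx // => D'.
  by rewrite setDv => /imsetP[z]; rewrite inE.
have lC : last y w \in C :\ r.
  by case: sC => _ wCr _ _; apply: wCr; rewrite mem_last.
by move/(component_clique lC ew) => ->; apply: (IHw _ (last y w)).
Qed.

Lemma word_of_search_tree (T : {ffun V -> option V}) u (C : {set V}) c :
    search_tree_on (G := SPK p n) T u C -> c \in C -> clique c ->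
  exists2 w, spans C w & forall x, x \in C -> T x = parent_in u w x.
Proof.
move=> TC; elim: TC c => {}u {}C r rC Tr TD IH c cC cc.
have [k /andP[kC ck]|noc] := pickP (fun k => (k \in C :\ r) && clique k).
  have [D CD kD] := component_ex (G := SPK p n) kC.
  have DE := component_clique kC ck CD; subst D.
  have [w [uw wC Cw ew] Tw] := IH _ CD k kC ck; exists (r :: w).
    split=> /=.
    - by rewrite uw andbT; apply/negP => /wC; rewrite !inE eqxx.
    - by move=> x; rewrite inE => /orP[/eqP->//|/wC /setD1P[]].
    - move=> x xC cx; rewrite inE; have [//|xr] := eqVneq x r.
      by apply: Cw => //; rewrite !inE xr.
    - by move: (Cw k kC ck) ew; case: (w).
  move=> x xC /=; case: eqP => [->//|/eqP xr].
  by apply: Tw; rewrite !inE xr.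
exists [:: r].
  split=> //=; first by move=> x; rewrite inE => /eqP->.
    by move=> x xC cx; have := noc x; rewrite !inE xC cx !andbT => /negbFE.
  suff /eqP<- : c == r by [].
  by have := noc c; rewrite !inE cC cc !andbT => /negbFE.
move=> x xC /=; case: eqP => [->//|/eqP xr].
have xCr : x \in C :\ r by rewrite !inE xr.
have [D CD xD] := component_ex (G := SPK p n) xCr.
have iCr z : z \in C :\ r -> ~~ clique z.
  by move=> zC; have := noc z; rewrite /= zC /= => ->.
have [y yC DE] := component_indep iCr CD.
move: xD (TD _ CD); rewrite DE inE => /eqP <- TC.
case: {-1}_ {-1}_ / TC (erefl [set x]) (erefl (Some r)).
by move=> u' C' z zC' Tz _ CE uE; move: zC' Tz; rewrite -CE -uE inE => /eqP->.
Qed.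

End Words.

(** * Rotations act on words *)

Section Trees.
Variables p n : nat.
Hypothesis p_gt0 : 0 < p.
Let V : finType := SPK p n.
Let tree : finType := search_tree (SPK p n).
Implicit Types (x y : V) (w s t : seq V) (T : tree).

(** The word can be read off the tree from the root downwards.  The generality
    in [u] serves the induction. *)
Lemma parent_in_inj u w w' : uniq w -> uniq w' ->
    (forall x, Some x = u -> x \notin w ++ w') ->
    (forall x, clique x -> (x \in w) = (x \in w')) ->
    clique_end w -> clique_end w' ->
    {in w ++ w', forall x, parent_in u w x = parent_in u w' x} ->
  w = w'.
Proof.
elim: w u w' => [|x s IHs] u [|x' s'] //=.
- by move=> _ _ _ /(_ (last x' s')) + _ ew; rewrite ew mem_last => /(_ isT).
- by move=> _ _ _ /(_ (last x s)) + ew; rewrite ew mem_last => /(_ isT).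
move=> /andP[xs us] /andP[xs' us'] uN cE ew ew' parE.
have xx' : x = x'.
  apply/eqP; apply: contraT => xx'; have := parE x (mem_head _ _).
  rewrite eqxx (negPf xx'); case: u uN {parE} => [z|] uN ue.
    have := uN z erefl; rewrite !(inE, mem_cat) !negb_or => /and4P[_ _ zx' zs'].
    case/esym/parent_in_range: ue => [[zE]|]; last by rewrite (negPf zs').
    by rewrite zE eqxx in zx'.
  by case: (parent_in_Some (esym ue)).
subst x'; congr (_ :: _); apply: (IHs (Some x)) => //.
- by move=> y [->]; rewrite mem_cat negb_or xs.
- move=> y cy; have := cE y cy; rewrite !inE; have [->|//] := eqVneq y x.
  by rewrite (negPf xs) (negPf xs').
- by case: (s) ew.
- by case: (s') ew'.
move=> y ys; have := parE y; rewrite !(inE, mem_cat).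
have [yx|_] := eqVneq y x; last by apply; move: ys; rewrite mem_cat.
by move: ys; rewrite yx mem_cat (negPf xs) (negPf xs').
Qed.

Lemma tree_word_ex T :
  exists w, valid w && (parent T == [ffun x => parent_in None w x]).
Proof.
have [w sw Tw] := word_of_search_tree (c := inl (Ordinal p_gt0))
  (search_tree_parentP T) (in_setT _) isT.
exists w; apply/andP; split; first exact/validP.
by apply/eqP/ffunP=> x; rewrite ffunE Tw ?inE.
Qed.

Definition word T := xchoose (tree_word_ex T).

Lemma word_valid T : valid (word T).
Proof. by have /andP[] := xchooseP (tree_word_ex T). Qed.

Lemma parentE T x : T x = parent_in None (word T) x.
Proof. by have /andP[_ /eqP->] := xchooseP (tree_word_ex T); rewrite ffunE. Qed.

Lemma word_inj : injective word.
Proof.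
by move=> T T' TT'; apply/val_inj/ffunP => x; rewrite /= !parentE TT'.
Qed.

Lemma word_surj w : valid w -> exists T, word T = w.
Proof.
move=> vw; have sw := validP _ vw.
have Tw : search_treeb (G := SPK p n) [ffun x => parent_in None w x]
    #|SPK p n| None [set: SPK p n].
  apply/search_treeP; first by rewrite cardsT.
  apply: (@search_tree_of_word _ _ _ _ _ w (inl (Ordinal p_gt0))) => // x _.
  by rewrite ffunE.
exists (SearchTree Tw); have /validP[uw _ cw ew] := vw.
have /validP[uw' _ cw' ew'] := word_valid (SearchTree Tw).
apply: (@parent_in_inj None) => // [x cx|x _].
  by rewrite cw ?cw' ?inE.
by rewrite -parentE ffunE.
Qed.

(** [Drop] and [Insert] are rotations along the edge between the last clique
    vertex [c] and, respectively, the vertex above it or a leaf below it. *)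
Inductive word_step : seq V -> seq V -> Prop :=
| Swap s x y t : word_step (s ++ [:: x, y & t]) (s ++ [:: y, x & t])
| Drop s x c : word_step (s ++ [:: x; c]) (s ++ [:: c])
| Insert s x c : word_step (s ++ [:: c]) (s ++ [:: x; c]).

Lemma word_step_sym w w' : word_step w w' -> word_step w' w.
Proof. by case; constructor. Qed.

Lemma subtree_leaf T x : x \notin word T -> subtree T x = [set x].
Proof.
move=> xw; apply/setP=> z; rewrite !inE.
apply/idP/eqP => [|->]; last exact: connect0.
case/connectP=> s; case/lastP: s => [//|s y].
rewrite rcons_path last_rcons => /andP[_].
move=> + xy; rewrite -xy parentE => /eqP/parent_in_range[//|].
by rewrite (negPf xw).
Qed.

Lemma subtree_spine T s x t t' :
  word T = s ++ x :: t ++ t' -> last x t \in subtree T x.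
Proof.
have /validP[uw _ _ _] := word_valid T.
rewrite inE; elim/last_ind: t t' => [|t y IHt] t' wE /=; first exact: connect0.
rewrite last_rcons; apply: (@connect_trans _ _ (last x t)); last first.
  by apply: (IHt (y :: t')); rewrite wE cat_rcons.
apply: connect1; rewrite parentE.
have {}wE : word T = (s ++ x :: t) ++ y :: t' by rewrite wE cat_rcons -catA.
move: uw; rewrite wE cat_uniq /= => /and3P[_ /norP[/= yN _] _].
by rewrite parent_in_cat (negPf yN) /= eqxx map_cat last_cat /= last_map.
Qed.

(** If [v] is a leaf, the rotation inserts it above [u], the last letter.  If
    [v] is the last letter and [u] is independent, then the leaves below [v] are
    not adjacent to [u]; they stay under [v] and [u] joins them.  In all other
    cases, everything below [v] contains a clique vertex or is adjacent to the
    clique vertex [u], so that it moves under [u], and [u] and [v] are just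
    exchanged. *)
Lemma rotates_step T u v : T v = Some u ->
  exists2 T' : tree, parent T' = rotate T u v & word_step (word T) (word T').
Proof.
rewrite parentE => Tvu; have /validP[uw _ cw ew] := word_valid T.
suff [w' vw' [parw' st]] : exists2 w', valid w' &
    (forall x, rotate T u v x = parent_in None w' x) /\ word_step (word T) w'.
  have [T' w'E] := word_surj vw'; subst w'.
  by exists T' => //; apply/ffunP => x; rewrite parw' parentE.
have spine z : clique z -> z \in word T by move=> cz; apply: cw; rewrite ?inE.
have parR x (w' : seq V) y : parent_in None w' x = Some y -> y \in w'.
  by case/parent_in_range.
have [[s [t wE]]|[vw [s wE]]] := parent_in_SomeP uw Tvu.
  move: (uw); rewrite wE cat_uniq /= !inE.
  move=> /and3P[us0 /norP[us /norP[vs ts]] /andP[/norP[uv ut] /andP[vt ut0]]].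
  have eqT x : T x = if x \in s then parent_in None s x else
      if x == u then last None (map Some s) else
      if x == v then Some u else parent_in (Some v) t x.
    by rewrite parentE wE parent_in_cat.
  have Tu : T u = last None (map Some s) by rewrite eqT (negPf us) eqxx.
  have Tns x : x \in s -> (T x == Some v) = false.
    by move=> xs; apply/eqP; rewrite eqT xs => /parR; apply/negP.
  have [/andP[/eqP t0 cu]|tu] := boolP ((t == [::]) && ~~ clique u).
    subst t; exists (s ++ [:: v]).
      apply/and3P; split.
      - by rewrite cat_uniq us0 /= orbF vs.
      - apply/forallP=> x; apply/implyP=> cx; have := spine x cx.
        rewrite wE !mem_cat !inE; case: (x =P u) => // xu.
        by rewrite -xu cx in cu.
      - by move: ew; rewrite wE !clique_end_cat.
    split; last by constructor.
    move=> x; rewrite ffunE Tu parent_in_cat /=.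
    have [->|xu] := eqVneq x u; first by rewrite (negPf us) (negPf uv).
    have [->|xv] := eqVneq x v; first by rewrite (negPf vs).
    have [xs|/negbTE xs] := boolP (x \in s); first by rewrite Tns //= eqT xs.
    have Tx : T x = Some v by rewrite eqT xs (negPf xu) (negPf xv).
    rewrite Tx eqxx andTb ifN //; apply/exists_inP => -[z].
    have xw : x \notin word T.
      by rewrite wE mem_cat xs !inE (negPf xu) (negPf xv).
    rewrite (subtree_leaf xw) inE => /eqP->.
    move: (SPK_edgeE u x) => /= ->; rewrite (negPf cu) andbC /=.
    case cx: (clique x) => //.
    by rewrite spine in xw.
  exists (s ++ [:: v, u & t]).
    apply/and3P; split.
    - by rewrite cat_uniq us0 /= !inE !negb_or (eq_sym v) uv ut vt ut0 us vs ts.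
    - apply/forallP=> x; apply/implyP=> /spine.
      by rewrite wE !mem_cat !inE; case: (x == u); rewrite /= ?orbT.
    - move: ew tu; rewrite wE !clique_end_cat /=; case: (t) => //= _.
      by rewrite negbK.
  split; last by constructor.
  move=> x; rewrite ffunE Tu parent_in_cat /=.
  have [->|xu] := eqVneq x u; first by rewrite (negPf us) (negPf uv).
  have [->|xv] := eqVneq x v; first by rewrite (negPf vs).
  have [xs|/negbTE xs] := boolP (x \in s); first by rewrite Tns //= eqT xs.
  have Tx : T x = parent_in (Some v) t x.
    by rewrite eqT xs (negPf xu) (negPf xv).
  case: (T x =P Some v) => Txv; last first.
    by rewrite /= Tx; apply/esym/(parent_in_change _ erefl vt); rewrite -Tx.
  rewrite (_ : parent_in (Some u) t x = Some u); last first.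
    case: (parent_in_eq erefl vt (etrans (esym Tx) Txv)) => [->|[t' ->]] //=.
    by rewrite eqxx.
  rewrite ifT //; apply/exists_inP.
  case: (parent_in_eq erefl vt (etrans (esym Tx) Txv)) => [t0|[t' t0]].
    exists x; first by rewrite inE connect0.
    by move: tu (SPK_edgeE u x); rewrite t0 /= negbK eq_sym xu => -> ->.
  (* The last letter is a clique vertex in the subtree of [x]. *)
  exists (last x t').
    apply: (@subtree_spine _ (s ++ [:: u; v]) _ _ [::]).
    by rewrite wE t0 cats0 -catA.
  move: (SPK_edgeE u (last x t')) => /= ->; apply/andP; split.
    by apply: contraNneq ut => ->; rewrite t0 mem_last.
  by move: ew; rewrite wE clique_end_cat t0 /= => ->; rewrite orbT.
have cu : clique u by move: ew; rewrite wE -cats1 clique_end_cat.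
exists (s ++ [:: v; u]).
  apply/and3P; split.
  - move: uw vw; rewrite wE rcons_uniq mem_rcons inE negb_or.
    case/andP=> us us0 /andP[vu vs].
    by rewrite cat_uniq us0 /= inE vu !negb_or vs us.
  - apply/forallP=> x; apply/implyP=> /spine.
    rewrite wE mem_rcons mem_cat !inE; case: (x == u); rewrite ?orbT //=.
    by move=> ->.
  - by rewrite clique_end_cat.
split; last by rewrite wE -cats1; constructor.
move: uw vw; rewrite wE rcons_uniq mem_rcons inE negb_or.
move=> /andP[us us0] /andP[vu vs].
have eqT x : T x = if x \in s then parent_in None s x else
    if x == u then last None (map Some s) else Some u.
  by rewrite parentE wE -cats1 parent_in_cat.
move=> x; have Txv : (T x == Some v) = false.
  apply/eqP; rewrite parentE wE => /parR; rewrite mem_rcons inE (negPf vu) /=.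
  exact/negP.
rewrite ffunE parent_in_cat /= Txv.
have [->|xu] := eqVneq x u; first by rewrite (negPf us) eq_sym (negPf vu).
have [->|xv] := eqVneq x v; first by rewrite (negPf vs) eqT (negPf us) eqxx.
by rewrite eqT (negPf xu).
Qed.

Lemma edge_step T T' : rotation_edge T T' -> word_step (word T) (word T').
Proof.
have rs T1 T2 : rotates_to T1 T2 -> word_step (word T1) (word T2).
  case/existsP=> u /existsP[v /andP[/eqP /rotates_step[T3 pT3 st]] /eqP pT2].
  by rewrite (_ : T2 = T3) //; apply: val_inj; rewrite /= pT2 pT3.
by case/orP=> /rs // /word_step_sym.
Qed.

(** After the rotation, [v] is the parent of [u].  If the rotation along another
    edge of the tree gave [u] the same parent, then the tree would contain a
    cycle of length at most 3. *)
Lemma rotate_inj T u v u' v' : T v = Some u -> T v' = Some u' ->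
  rotate T u v = rotate T u' v' -> v = v'.
Proof.
have /validP[uw _ _ _] := word_valid T.
have idx x y : T x = Some y -> index y (word T) < index x (word T).
  by rewrite parentE; apply: parent_in_index.
move=> Tv Tv' /ffunP/(_ u); rewrite !ffunE eqxx.
have [uu'|uu'] := eqVneq u u'; first by case.
have lt1 := idx _ _ Tv; have lt2 := idx _ _ Tv'.
have [uv'|uv'] := eqVneq u v'.
  move=> /esym /idx lt3; rewrite uv' in lt1.
  by have := ltn_trans lt3 (ltn_trans lt2 lt1); rewrite ltnn.
case: ifP => [/andP[/eqP Tu _] [vu']|_ /esym/idx].
  subst v; move: (ltn_trans (idx _ _ Tu) lt1) => lt3.
  by move: (ltn_trans lt2 lt3); rewrite ltnn.
by move=> lt3; move: (ltn_trans lt1 lt3); rewrite ltnn.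
Qed.

Lemma rotation_degree T : p + n - 1 <= #|[set T' | rotation_edge T T']|.
Proof.
pose f v := odflt T [pick T' | parent T' == rotate T (odflt v (T v)) v].
have fP v u : T v = Some u -> parent (f v) = rotate T u v.
  move=> Tv; rewrite /f Tv /=; case: pickP => [T' /eqP //|no].
  by have [T' T'E _] := rotates_step Tv; have := no T'; rewrite T'E eqxx.
pose D := [set v | T v != None].
have DP v : v \in D -> exists u, T v = Some u.
  by rewrite inE; case: (T v) => // u; exists u.
have : p + n - 1 <= #|D|.
  pose c : V := inl (Ordinal p_gt0).
  have nD : ~: D \subset [set head c (word T)].
    apply/subsetP=> x; rewrite !inE negbK parentE.
    have /validP[_ _ /(_ c (in_setT _) isT) + _] := word_valid T.
    case: (word T) => //= y t _; case: (x =P y) => // _ /eqP.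
    by case/parent_in_Some.
  have -> : p + n = #|SPK p n| by rewrite card_sum !card_ord.
  rewrite -(cardsC D) leq_subLR addnC leq_add2r.
  by rewrite (leq_trans (subset_leq_card nD)) ?cards1.
move/leq_trans; apply; rewrite -(card_in_imset (f := f)).
  apply/subset_leq_card/subsetP=> _ /imsetP[v /DP[u Tv] ->].
  rewrite inE; apply/orP; left.
  apply/existsP; exists u; apply/existsP; exists v.
  by rewrite Tv (fP _ _ Tv) !eqxx.
move=> v v' /DP[u Tv] /DP[u' Tv'] ff'; apply: (rotate_inj Tv Tv').
by rewrite -!fP // ff'.
Qed.

End Trees.

(** * Inserting a letter *)

Section Insertion.
Variable V : eqType.
Implicit Types (x y : V) (z : seq V) (i : nat).

Definition ins x i z := take i z ++ x :: drop i z.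

Lemma mem_ins x i z y : (y \in ins x i z) = (y == x) || (y \in z).
Proof. by rewrite -[in RHS](cat_take_drop i z) !mem_cat inE orbCA. Qed.

Lemma ins_uniq x i z : uniq (ins x i z) = (x \notin z) && uniq z.
Proof.
rewrite (perm_uniq (s2 := x :: z)) // -[in X in perm_eq _ X](cat_take_drop i z).
by rewrite /ins perm_catC /= perm_cons perm_catC.
Qed.

Lemma size_ins x i z : size (ins x i z) = (size z).+1.
Proof. by rewrite -[in RHS](cat_take_drop i z) !size_cat addnS. Qed.

Lemma ins_cat x s t : ins x (size s) (s ++ t) = s ++ x :: t.
Proof. by rewrite /ins take_size_cat // drop_size_cat. Qed.

Lemma filter_ins x i z : x \notin z -> filter (predC1 x) (ins x i z) = z.
Proof.
move=> xz; rewrite filter_cat /= eqxx -filter_cat cat_take_drop.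
by apply/all_filterP/allP => y yz /=; apply: contraNneq xz => <-.
Qed.

Lemma index_ins x i z : x \notin z -> i <= size z -> index x (ins x i z) = i.
Proof.
move=> xz iz; rewrite index_cat /= eqxx addn0 size_takel //.
by rewrite ifN //; apply: contra xz => /mem_take.
Qed.

Lemma index_ins_gt x y i z :
  y != x -> i <= size z -> i <= index y z -> i < index y (ins x i z).
Proof.
move=> yx iz; rewrite -{1}(cat_take_drop i z) !index_cat /= size_takel //.
case: ifP => yt; last by rewrite eq_sym (negPf yx) addnS ltnS leq_addr.
by rewrite -index_mem size_takel // in yt; rewrite leqNgt yt.
Qed.

End Insertion.

(** * Arithmetic of the double count *)

Lemma double_triangle_sum m : 2 * \sum_(0 <= i < m) (m.+1 - i) = m * (m + 3).
Proof.
elim: m => [|m IHm]; first by rewrite big_nil.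
by rewrite big_nat_recl // mulnDr IHm; lia.
Qed.

(** With l = p + q - 1 - m, the two sides differ by l * l - l. *)
Lemma base_size_bound p q m : m <= p + q - 1 -> 0 < p ->
  q * m.+1 + (p * p + p + p * q + q) <=
    m * (m + 3) + (2 * p + q) * (p + q - 1 - m) + 2.
Proof.
move=> le_m p_gt0; have [l lE] : exists l, l = p + q - 1 - m by eexists.
rewrite -lE; have -> : q = m + l + 1 - p by lia.
have [k kE] : exists k, m + l + 1 - p = k by eexists.
rewrite kE; have mE : m + l + 1 = p + k by lia.
have : l <= l * l by nia.
nia.
Qed.

(** This holds because p * p + p * q >= p + 2. *)
Lemma base_count_bound p q S B : 0 < p -> 1 < q -> S < B ->
  (2 * p + q) * S + 2 * B < B * (p * p + p + p * q + q).
Proof. nia. Qed.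

(** * The trees in which one independent vertex is above another *)

Section Counting.
Variables p n : nat.
Hypothesis p_gt0 : 0 < p.
Let V : finType := SPK p n.
Let tree : finType := rotation_graph (SPK p n).
Variables a b : V.
Hypotheses (ab : a != b) (ia : ~~ clique a) (ib : ~~ clique b).
Implicit Types (x y : V) (w s t z : seq V) (T : tree).
Let word := (word p_gt0 : tree -> seq V).

Definition words : seq (seq V) := [seq word T | T <- enum tree].

Lemma mem_words w : (w \in words) = valid w.
Proof.
apply/mapP/idP=> [[T _ ->]|/(word_surj p_gt0)[T <-]]; first exact: word_valid.
by exists T; rewrite ?mem_enum.
Qed.

Lemma words_uniq : uniq words.
Proof. by rewrite map_inj_uniq ?enum_uniq //; apply: word_inj. Qed.

(** A vertex which is a leaf has index [size w].  So this says that [a] is a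
    proper ancestor of [b], and it is false if both are leaves. *)
Definition above w := index a w < index b w.
Definition above_set : {set tree} := [set T | above (word T)].

Lemma card_word_filter (P : pred (seq V)) :
  #|[set T : tree | P (word T)]| = size (filter P words).
Proof.
rewrite /words filter_map size_map cardE; congr size.
rewrite /enum_mem -filter_predI; apply: eq_filter => T.
by rewrite /= !inE andbT.
Qed.

Lemma valid_ins x i z :
  valid z -> ~~ clique x -> x \notin z -> i < size z -> valid (ins x i z).
Proof.
case/and3P=> uz /forallP cz ez cx xz iz; apply/and3P; split.
- by rewrite ins_uniq xz.
- apply/forallP=> y; rewrite mem_ins; apply/implyP=> cy.
  by rewrite (implyP (cz y)) ?orbT.
move: ez; rewrite -{1}(cat_take_drop i z) /ins.
by rewrite (drop_nth x iz) !clique_end_cat.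
Qed.

(** Exchanging the names [a] and [b] maps this set into its complement. *)
Lemma card_above_set : #|above_set|.*2 <= #|tree|.
Proof.
pose f := map (tperm a b).
pose A := filter above words.
have -> : #|tree| = size words by rewrite size_map cardE.
rewrite card_word_filter -/A -addnn -{2}(size_map f) -size_cat.
have indexf x w : index x (f w) = index (tperm a b x) w.
  by rewrite -{1}(tpermK a b x) index_map //; apply: perm_inj.
apply: uniq_leq_size.
  rewrite cat_uniq filter_uniq ?words_uniq //.
  rewrite map_inj_uniq ?filter_uniq ?words_uniq ?andbT //.
    apply/hasPn=> _ /mapP[w wA ->]; move: wA.
    rewrite !mem_filter /above !indexf tpermL tpermR.
    by case: ltngtP.
  exact/inj_map/perm_inj.
move=> w; rewrite mem_cat !mem_filter => /orP[/andP[]//|/mapP[w0 + ->]].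
rewrite mem_filter !mem_words => /andP[_ /and3P[uw /forallP cw ew]] {w}.
have fc x : clique x -> tperm a b x = x.
  by move=> cx; rewrite tpermD //; apply: contraTneq cx => <-.
apply/and3P; split; first by rewrite map_inj_uniq //; apply: perm_inj.
  apply/forallP=> x; apply/implyP=> cx; rewrite -(fc x cx) mem_map.
    exact: implyP cx.
  exact: perm_inj.
by case: (w0) ew => //= x s; rewrite last_map => cl; rewrite fc.
Qed.

(** The words that remain when [a] and [b] are erased; they are also the words of
    the trees in which [a] and [b] are leaves. *)
Definition bases := [seq z <- words | (a \notin z) && (b \notin z)].

Lemma mem_bases z : (z \in bases) = [&& a \notin z, b \notin z & valid z].
Proof. by rewrite mem_filter mem_words andbA. Qed.

Lemma bases_uniq : uniq bases.
Proof. by rewrite filter_uniq ?words_uniq. Qed.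

(** [j = size z] encodes that [b] is a leaf. *)
Definition place_pair i j z := ins a i (if j < size z then ins b j z else z).

Definition slots m := [seq (i, j) | i <- iota 0 m, j <- iota i (m.+1 - i)].

Lemma mem_slots m i j : ((i, j) \in slots m) = [&& i < m, i <= j & j <= m].
Proof.
apply/allpairsPdep/idP => [[i' [j']]|].
  by rewrite !mem_iota => -[? ? [-> ->]]; lia.
by move=> ?; exists i, j; rewrite !mem_iota; split=> //; lia.
Qed.

Lemma slots_uniq m : uniq (slots m).
Proof.
apply: allpairs_uniq_dep => [|i _|[i j] [i' j'] _ _ [-> ->]] //; exact: iota_uniq.
Qed.

Lemma size_slots m : 2 * size (slots m) = m * (m + 3).
Proof.
rewrite size_allpairs_dep sumnE big_map -double_triangle_sum /index_iota subn0.
by under eq_bigr do rewrite size_iota.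
Qed.

(** The positions and the base word can be recovered from the result: [i] is the
    index of [a], and [j] is the index of [b] once [a] is erased. *)
Lemma place_pairP (i j : nat) z :
    a \notin z -> b \notin z -> (i, j) \in slots (size z) ->
  let z' := if j < size z then ins b j z else z in
  [/\ a \notin z', i <= size z', index b z' = j & filter (predC1 b) z' = z].
Proof.
rewrite mem_slots => az bz /and3P[iz ij jz] /=.
case: (ltnP j (size z)) => jz'.
  rewrite mem_ins negb_or ab az index_ins ?filter_ins //.
  by rewrite size_ins; split=> //; apply: ltnW; apply: ltnW.
split=> //; first exact: ltnW.
  by rewrite memNindex //; apply/eqP; rewrite eqn_leq jz' jz.
by apply/all_filterP/allP => y yz /=; apply: contraNneq bz => <-.
Qed.

Lemma above_lower : \sum_(z <- bases) size z * (size z + 3) <= 2 * #|above_set|.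
Proof.
under eq_bigr do rewrite -size_slots.
rewrite -big_distrr leq_mul2l /= card_word_filter.
pose L := [seq (z, ij) | z <- bases, ij <- slots (size z)].
have LP z i j : (z, (i, j)) \in L ->
    [/\ a \notin z, b \notin z, valid z & (i, j) \in slots (size z)].
  case/allpairsPdep => z' [ij' [+ h [zE ijE]]]; subst z' ij'.
  by rewrite mem_bases => /and3P[].
have <- : size L = \sum_(z <- bases) size (slots (size z)).
  by rewrite size_allpairs_dep sumnE big_map.
pose g (t : seq V * (nat * nat)) := place_pair t.2.1 t.2.2 t.1.
rewrite -(size_map g); apply: uniq_leq_size.
  rewrite map_inj_in_uniq.
    apply: allpairs_uniq_dep => [|z _|[z ij] [z' ij'] _ _ [-> ->]] //.
      exact: bases_uniq.
    exact: slots_uniq.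
  move=> [z [i j]] [z' [i' j']] /LP[az bz _ sz] /LP[az' bz' _ sz'].
  rewrite /g /place_pair /=.
  move: (place_pairP az bz sz) (place_pairP az' bz' sz') => /=.
  set y := if j < _ then _ else _; set y' := if j' < _ then _ else _.
  move=> [ay iy jy fy] [ay' iy' jy' fy'] E.
  have ii' : i = i' by rewrite -(index_ins ay iy) E index_ins.
  have yy' : y = y' by rewrite -(filter_ins i ay) E filter_ins.
  by rewrite -fy -fy' -jy -jy' yy' ii'.
move=> _ /mapP[[z [i j]] /LP[az bz vz sz] ->]; rewrite /g /place_pair /=.
have [ay iy jy _] := place_pairP az bz sz.
move: (sz); rewrite mem_slots => /and3P[iz ij jz].
rewrite mem_filter mem_words /above index_ins //; apply/andP; split.
  by apply: index_ins_gt; rewrite 1?eq_sym // jy.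
apply: valid_ins => //; last by case: ifP => // _; rewrite size_ins ltnW.
by case: ifP => // jz'; apply: valid_ins.
Qed.

Lemma above_cat s t t' :
  (a \in s) || (b \in s) -> above (s ++ t) = above (s ++ t').
Proof.
rewrite /above !index_cat; have [as_|_] := boolP (a \in s);
  have [bs|_] := boolP (b \in s) => // _; move: (index_mem a s) (index_mem b s).
  by rewrite as_ => lt _; rewrite !(leq_trans lt) ?leq_addr.
rewrite bs => _ /ltnW lt; rewrite !ltnNge.
by rewrite !(leq_trans lt) ?leq_addr.
Qed.

(** The relative order of [a] and [b] is decided by the first of them that
    occurs, so a step changes it only where neither has occurred before. *)
Lemma boundary_words w w' :
    valid w -> word_step w w' -> above w -> ~~ above w' ->
  (exists z i, [/\ z \in bases, i < size z
    & w = ins a i (ins b i z) /\ w' = ins b i (ins a i z)])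
  \/ (exists2 z, z \in bases & w = ins a (size z).-1 z /\ w' = z).
Proof.
have first_ab s t t' :
    above (s ++ t) -> ~~ above (s ++ t') -> a \notin s /\ b \notin s.
  move=> abt abt'; apply/norP; apply: contra abt' => ab_s.
  by rewrite (@above_cat s t' t ab_s).
move=> vw st; case: st vw => {w w'} [s x y t|s x c|s x c]
  /and3P[+ /forallP cw]; rewrite clique_end_cat.
- rewrite cat_uniq /= !inE.
  move=> /and3P[us /norP[xs /norP[ys ts]] /and3P[/norP[xy xt] yt ut]] ew abw abw'.
  have [as_ bs] := first_ab _ _ _ abw abw'.
  have [xa yb] : x = a /\ y = b.
    move: abw abw'; rewrite /above !index_cat (negPf as_) (negPf bs) !ltn_add2l /=.
    have [xa|xa] := eqVneq x a.
      rewrite (negPf (_ : x != b)) ?xa // (negPf (_ : y != a)) -1?xa 1?eq_sym //.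
      by case: eqP.
    have [xb|xb] := eqVneq x b; first by rewrite ltn0.
    have [ya|ya] := eqVneq y a; first by rewrite (negPf (_ : y != b)) ?ya.
    by have [yb|yb] := eqVneq y b => [|->].
  subst x y; left; exists (s ++ t), (size s).
  (* The last letter is a clique vertex, hence it is not [b]. *)
  case: t => [|c t] in us xs ys ts xt yt ut ew abw abw' cw *.
    by rewrite /= (negPf ib) in ew.
  rewrite size_cat /= addnS ltnS leq_addr !ins_cat; split=> //.
  rewrite mem_bases (mem_cat a) (mem_cat b) (negPf xs) (negPf xt).
  rewrite (negPf ys) (negPf yt) /=; apply/and3P; split.
  + by rewrite cat_uniq us ts ut.
  + apply/forallP=> z; apply/implyP=> cz; have := implyP (cw z) cz.
    have za : z != a by apply: contraTneq cz => ->.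
    have zb : z != b by apply: contraTneq cz => ->.
    by rewrite !mem_cat in_cons (negPf za) in_cons (negPf zb).
  by rewrite clique_end_cat.
- rewrite cat_uniq /= !inE => /and3P[us /norP[xs /norP[cs _]] xc] cc abw abw'.
  have [as_ bs] := first_ab _ _ _ abw abw'.
  have ca : c == a = false by apply: contraTF cc => /eqP->.
  have cb : c == b = false by apply: contraTF cc => /eqP->.
  move: abw; rewrite /above !index_cat (negPf as_) (negPf bs) ltn_add2l /= ca cb.
  have [xa _|xa] := eqVneq x a; last by case: ifP => _; rewrite ?ltn0 ?ltnn.
  have zE : ins a (size (s ++ [:: c])).-1 (s ++ [:: c]) = s ++ [:: x; c].
    by rewrite size_cat addn1 ins_cat xa.
  right; exists (s ++ [:: c]) => //.
  rewrite mem_bases !mem_cat !inE !negb_or as_ bs !(eq_sym _ c) ca cb /=.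
  apply/and3P; split.
  + by rewrite cat_uniq us /= orbF cs.
  + apply/forallP=> z; apply/implyP=> cz; have := implyP (cw z) cz.
    have zx : z != x by apply: contraTneq cz => ->; rewrite xa.
    by rewrite !mem_cat in_cons (negPf zx).
  by rewrite clique_end_cat.
(* Before an insertion, if neither [a] nor [b] occurs above the last letter,
   then both are leaves. *)
move=> uw /= cc abw abw'; have [as_ bs] := first_ab _ _ _ abw abw'.
have ca : c == a = false by apply: contraTF cc => /eqP->.
move: abw; rewrite /above !index_cat (negPf as_) (negPf bs) ltn_add2l /= ca.
by case: ifP.
Qed.

Lemma cut_upper : #|cut above_set| <= \sum_(z <- bases) (size z).+1.
Proof.
pose L := [seq (ins a i (ins b i z), ins b i (ins a i z))
            | z <- bases, i <- iota 0 (size z)]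
  ++ [seq (ins a (size z).-1 z, z) | z <- bases].
have -> : \sum_(z <- bases) (size z).+1 = size L.
  rewrite size_cat size_map size_allpairs_dep sumnE big_map.
  under [X in _ = X + _]eq_bigr do rewrite size_iota.
  under eq_bigr do rewrite -addn1.
  by rewrite big_split sum1_size.
pose g (e : tree * tree) := (word e.1, word e.2).
rewrite cardE -(size_map g); apply: uniq_leq_size.
  rewrite map_inj_uniq ?enum_uniq // => -[T1 T2] [T1' T2'] [].
  by move=> /word_inj -> /word_inj ->.
move=> _ /mapP[[T T'] + ->]; rewrite mem_enum !inE /g /= => /and3P[aT aT' TT'].
rewrite mem_cat; apply/orP.
case: (boundary_words (word_valid p_gt0 T) (edge_step p_gt0 TT') aT aT').
  case=> z [i [zb iz [wE wE']]]; left; apply/allpairsPdep; exists z, i.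
  by rewrite mem_iota add0n; split=> //; congr (_, _).
by case=> z zb [wE wE']; right; apply/mapP; exists z => //; congr (_, _).
Qed.

Lemma card_V : #|V| = p + n.
Proof. by rewrite card_sum !card_ord. Qed.

Lemma base_uniq z : z \in bases -> uniq [:: a, b & z].
Proof. by rewrite mem_bases /= inE negb_or ab => /and3P[-> -> /and3P[->]]. Qed.

Lemma size_base z : z \in bases -> 0 < size z <= p + n - 2.
Proof.
move=> zb; have /card_uniqP /= sz := base_uniq zb.
have := max_card (mem [:: a, b & z]); rewrite sz card_V => le.
move: zb; rewrite mem_bases => /and3P[_ _ /and3P[_ + _]].
move/forallP/(_ (inl (Ordinal p_gt0))) => /=.
by case: (z) le => //= x s; lia.
Qed.

(** The sum counts the pairs of a base word [z] and a vertex [x] outside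
    [a :: b :: z]; for these, [x :: z] is again a base word, and it determines
    the pair.  The word [z0], which consists of the clique only, is not obtained
    in this way, hence the strict inequality. *)
Lemma leaves_lt : \sum_(z <- bases) (p + n - 2 - size z) < size bases.
Proof.
pose leaves z := enum [predC mem [:: a, b & z]].
pose L := [seq x :: z | z <- bases, x <- leaves z].
have -> : \sum_(z <- bases) (p + n - 2 - size z) = size L.
  rewrite size_allpairs_dep sumnE big_map; apply: eq_big_seq => z zb.
  have /card_uniqP /= sz := base_uniq zb.
  rewrite /leaves -cardE -card_V -(cardC (mem [:: a, b & z])) sz !addSn !subSS subn0.
  exact: addKn.
pose z0 : seq V := map inl (enum 'I_p).
apply: (@uniq_leq_size _ (z0 :: L)).
  rewrite /=; apply/andP; split.
    apply/negP=> /allpairsPdep[z [x [zb + zE]]].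
    have cx : clique x.
      have : x \in z0 by rewrite zE mem_head.
      by case/mapP=> i _ ->.
    move: zb; rewrite mem_bases => /and3P[_ _ /and3P[_ + _]].
    move=> /forallP/(_ x)/implyP/(_ cx) xz.
    by rewrite mem_enum !inE xz !orbT.
  apply: allpairs_uniq_dep => [|z _|[z x] [z' x'] _ _ [-> ->]] //.
    exact: bases_uniq.
  exact: enum_uniq.
move=> y; rewrite inE => /orP[/eqP->|/allpairsPdep[z [x [zb + ->]]]];
  rewrite mem_bases.
  have inl_z0 x : (x \in z0) = clique x.
    apply/mapP/idP=> [[i _ ->] //|]; case: x => // i _.
    by exists i; rewrite ?mem_enum.
  rewrite !inl_z0 ia ib /=; apply/and3P; split.
  - by rewrite map_inj_uniq ?enum_uniq // => i j [].
  - by apply/forallP=> x; rewrite inl_z0 implybb.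
  case: z0 inl_z0 => // x s inl_z0.
  by rewrite /= -inl_z0 mem_last.
rewrite mem_enum !inE !negb_or => /and3P[xa xb xz].
move: zb; rewrite mem_bases => /and3P[az bz /and3P[uz /forallP cz ez]].
rewrite !(eq_sym _ x) xa xb az bz /=; apply/and3P; split=> /=.
- by rewrite xz.
- by apply/forallP=> k; apply/implyP=> ck; rewrite inE (implyP (cz k)) ?orbT.
by move: (cz (inl (Ordinal p_gt0))) ez; case: (z).
Qed.

Lemma two_independent : 1 < n.
Proof.
case: a b ab ia ib => [//|i] [//|j] ij _ _.
have : i != j by apply: contraNneq ij => ->.
have := ltn_ord i; have := ltn_ord j; rewrite -val_eqE /=; lia.
Qed.

Lemma cut_lt : n.-1 * #|cut above_set| < 2 * #|above_set|.
Proof.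
apply: leq_ltn_trans (leq_mul (leqnn n.-1) cut_upper) _.
apply: leq_trans above_lower; set q := n.-1.
have nq : n = q.+1 by rewrite /q prednK // ltnW // two_independent.
have q0 : 0 < q by have := two_independent; lia.
have leaves0 := leaves_lt; rewrite big_distrr /=.
have npq : p + n - 2 = p + q - 1 by rewrite nq addnS subSS.
rewrite npq in leaves0; have [q1|q2] : q = 1 \/ 1 < q by lia.
  (* The averaging argument is too weak for p = q = 1, but for q = 1 the
     inequality holds term by term. *)
  have : \sum_(z <- bases) (q * (size z).+1 + 1) <=
      \sum_(z <- bases) size z * (size z + 3).
    rewrite !big_seq; apply: leq_sum => z /size_base/andP[].
    by rewrite q1; case: (size z) => // m _ _; lia.
  rewrite big_split /= sum1_size; apply: leq_trans; rewrite -addn1 leq_add2l.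
  exact: leq_ltn_trans leaves0.
have : \sum_(z <- bases) (q * (size z).+1 + (p * p + p + p * q + q)) <=
    \sum_(z <- bases)
      (size z * (size z + 3) + (2 * p + q) * (p + q - 1 - size z) + 2).
  rewrite !big_seq; apply: leq_sum => z /size_base/andP[_]; rewrite npq => zs.
  exact: base_size_bound.
have := base_count_bound p_gt0 q2 leaves0.
rewrite !big_split /= -!big_distrr /= !big_const_seq !count_predT !iter_addn_0.
move: (\sum_(z <- bases) (p + q - 1 - size z)) (size bases) => A B.
move: (\sum_(z <- bases) (size z).+1) => C.
move: (\sum_(z <- bases) size z * (size z + 3)) => D.
by clear; nia.
Qed.

End Counting.

(** * Expansion and second eigenvalue of the rotation graph *)

Local Open Scope ring_scope.

Theorem corollary3 (R : rcfType) (p q : nat) (hp : (1 <= p)%N) (hq : (1 <= q)%N) :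
  edge_expansion R (rotation_graph (SPK p q.+1)) < 2 / q%:R
  /\ lambda2 R (rotation_graph (SPK p q.+1)) > p%:R + q%:R - 4 / q%:R.
Proof.
set H := rotation_graph _.
pose a : SPK p q.+1 := inr ord0; pose b : SPK p q.+1 := inr ord_max.
have ab : a != b by apply: contraTneq hq => -[<-].
pose A : {set H} := above_set hp a b.
have lt_cut : (q * #|cut A| < 2 * #|A|)%N := cut_lt hp ab isT isT.
have A_gt0 : (0 < #|A|)%N by move: lt_cut; case: #|A|; rewrite ?muln0.
have A0 : A != set0 by rewrite -card_gt0.
have leA : (#|A|.*2 <= #|H|)%N := @card_above_set _ _ hp a b isT isT.
have ratio_lt : #|cut A|%:R / #|A|%:R < 2 / q%:R :> R.
  rewrite ltr_pdivrMr ?ltr0n // mulrAC ltr_pdivlMr ?ltr0n // mulrC.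
  by rewrite -!natrM ltr_nat.
split; first exact: le_lt_trans (edge_expansion_le_cut R A0 leA) ratio_lt.
(* The second part follows from the first estimate since 4 / q = 2 * (2 / q). *)
have degH x : (p + q <= #|[set y : H | edge x y]|)%N.
  by have := rotation_degree hp x; rewrite addnS subn1.
apply: lt_le_trans (lambda2_ge_cut R degH A0 leA).
rewrite natrD ltrD2l ltrN2 -[2 * _ / _]mulrA (_ : 4 / q%:R = 2 * (2 / q%:R)).
  by rewrite ltr_pM2l ?ltr0n.
by rewrite mulrA -natrM.
Qed.
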